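(* Let $f$ be a real arithmetic function for which the logarithmic polynomial $p_f(\log x)$ is defined, and let $c$ be its degree. For $H\ge h$ with $h\to\infty$ and $H=o(N)$ as $N\to\infty$, one has $$\widetilde{J}_f(N,H)\ll \frac{H^2}{h^2}\,\widetilde{J}_f(N,h)+\Big(\frac{Nh^4}{H^2}+H^3\Big)\|f\|_\infty^2+H^3(\log N)^{2c}.$$
   Context: The logarithmic polynomial of $f$ is defined when the Dirichlet series $F(s)=\sum_n f(n)n^{-s}$ is meromorphic in $\mathbb{C}$ and absolutely convergent at least in the half-plane $\Re(s)>1$; then $p_f(\log x)=\mathrm{Res}_{s=1}F(s)x^{s-1}$, a polynomial in $\log x$ of degree $c$. Set $M_f(x,h)=h\,p_f(\log x)$. For $\delta>0$, the Cesàro weight is $C_\delta(y)=\max(1-\delta^{-1}|y|,0)$. The modified Selberg integral is $\widetilde{J}_f(N,h)=\sum_{x\sim N}\big|\sum_n C_h(n-x)f(n)-M_f(x,h)\big|^2$, where $x\sim N$ means $x$ runs over the integers in $(N,2N]$ and $n$ over positive integers. $\|f\|_\infty=\max_{N-H\le n\le 2N+H}|f(n)|$. *)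

(* Defs.v *)
From HB Require Import structures.
From mathcomp Require Import all_boot all_order all_algebra.
From mathcomp Require Import all_classical all_reals all_analysis.
From mathcomp Require Import complex.

Set Implicit Arguments.
Unset Strict Implicit.
Unset Printing Implicit Defensive.

Import Order.TTheory GRing.Theory Num.Theory.
Import numFieldNormedType.Exports.

Local Open Scope classical_set_scope.
Local Open Scope ring_scope.
Local Open Scope complex_scope.

(* The complex plane is [R[i]^o]: the alias [^o] makes R[i] a normed module over
   itself, so that [derivable g z 1] is complex differentiability of g at z. *)

Definition cexp (R : realType) (z : R[i]) : R[i] :=
  (expR (complex.Re z) * cos (complex.Im z)) +i*
  (expR (complex.Re z) * sin (complex.Im z)).

(* x ^ s for x > 0, with the real logarithm of x. *)
Definition cpow (R : realType) (x : R) (s : R[i]) : R[i] :=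
  cexp (s * (ln x)%:C).

Definition holomorphic_near (R : realType) (g : R[i]^o -> R[i]^o)
    (z0 : R[i]^o) : Prop :=
  \forall z \near z0, derivable g z 1.

(* Removable singularities are allowed: the values of g on a discrete set are
   irrelevant. *)
Definition meromorphic (R : realType) (g : R[i]^o -> R[i]^o) : Prop :=
  forall z0 : R[i]^o, exists (k : nat) (phi : R[i]^o -> R[i]^o),
    holomorphic_near phi z0 /\
    \forall z \near z0^', (z - z0) ^+ k * g z = phi z.

(* a is the coefficient of (z - z0)^-1 in the Laurent expansion of g at z0;
   the principal part of g is q evaluated at (z - z0)^-1, the constant term of
   q being absorbed by the holomorphic part. *)
Definition is_residue (R : realType) (g : R[i]^o -> R[i]^o) (z0 : R[i]^o)
    (a : R[i]) : Prop :=
  exists (q : {poly R[i]}) (psi : R[i]^o -> R[i]^o),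
    [/\ holomorphic_near psi z0,
        \forall z \near z0^', g z = q.[(z - z0)^-1] + psi z
      & a = q`_1].

(* The series runs over n >= 1, so its n-th term involves f n.+1; the value
   f 0 is never used. *)
Definition dirichlet_term (R : realType) (f : nat -> R) (s : R[i]) (n : nat) :
    R[i]^o :=
  (f n.+1)%:C * cpow n.+1%:R (- s).

Definition meromorphic_dirichlet_series (R : realType) (f : nat -> R)
    (F : R[i]^o -> R[i]^o) : Prop :=
  meromorphic F /\
  forall s : R[i], 1 < complex.Re s ->
    cvgn (series (fun n => Normc.normc (dirichlet_term f s n))) /\
    series (dirichlet_term f s) @ \oo --> F s.

(* Such a p is unique. When F continues the Dirichlet series of a real f it
   exists with real coefficients; it is 0 when F has no pole at 1. *)
Definition is_logarithmic_polynomial (R : realType) (F : R[i]^o -> R[i]^o)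
    (p : {poly R}) : Prop :=
  forall x : R, 0 < x ->
    is_residue (fun s => F s * cpow x (s - 1)) 1 (p.[ln x])%:C.

Definition cesaro_weight (R : realType) (delta y : R) : R :=
  Num.max (1 - delta^-1 * `|y|) 0.

Definition main_term (R : realType) (p : {poly R}) (x h : nat) : R :=
  h%:R * p.[ln x%:R].

(* For h > 0 the inner sum has finite support, since the Cesaro weight does. *)
Definition selberg_tilde (R : realType) (f : nat -> R) (p : {poly R})
    (N h : nat) : R :=
  \sum_(N.+1 <= x < (2 * N).+1)
    `| \sum_(n \in [set n : nat | (0 < n)%N])
         cesaro_weight h%:R (n%:R - x%:R) * f n
       - main_term p x h | ^+ 2.

(* The maximum of |f n| over N - H <= n <= 2 N + H; it is used for H < N only,
   where the natural subtraction is not truncated. *)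
Definition supnorm (R : realType) (f : nat -> R) (N H : nat) : R :=
  \big[Num.max/0]_(N - H <= n < (2 * N + H).+1) `|f n|.

(* Main.v *)
(** The Cesaro weight [C_H] differs from its piecewise linear interpolant
    [sum_j C_H(j h) C_h(y - j h)] at the multiples of [h] only on the two cells
    containing [+-H], and there by at most [h/H]. Applied to [f - p(log x)], this
    expresses the defect of [H] at [x], up to an error
    [O(h^2/H (||f|| + |p(log x)|))], as a sum of [O(H/h)] defects of [h] at the
    points [x + j h], plus [H] times the variation of [p(log)] over a distance
    [H], which is [O(H/N log^c N)]. Cauchy-Schwarz and summation over [N + H < x <= 2N - H]
    give the main term; the remaining [O(H)] values of [x] are estimated
    trivially. *)
Require Import Defs.
From HB Require Import structures.
From mathcomp Require Import all_boot all_order all_algebra.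
From mathcomp Require Import all_classical all_reals all_analysis.
From mathcomp Require Import complex.
From mathcomp Require Import ring lra zify.

Set Implicit Arguments.
Unset Strict Implicit.
Unset Printing Implicit Defensive.

Import Order.TTheory GRing.Theory Num.Theory.
Import numFieldNormedType.Exports.

Local Open Scope classical_set_scope.
Local Open Scope ring_scope.

Section WeightInterpolation.
Variable R : realType.
Implicit Types (f g : nat -> R) (p : {poly R}).

(** * Cesàro-weighted sums as finite sums *)

Definition cesaro_sum g (h x : nat) : R :=
  \sum_(n \in [set n : nat | (0 < n)%N])
     cesaro_weight h%:R (n%:R - x%:R) * g n.

Lemma cesaro_weight_ge0 (d y : R) : 0 <= cesaro_weight d y.
Proof. by rewrite /cesaro_weight le_max lexx orbT. Qed.

Lemma cesaro_weight_out (d y : R) : 0 < d -> d <= `|y| -> cesaro_weight d y = 0.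
Proof.
move=> d0 dy; rewrite /cesaro_weight; apply/max_idPr.
by rewrite subr_le0 -ler_pdivrMl ?invr_gt0// invrK mulr1.
Qed.

Lemma cesaro_weight_in (d y : R) : 0 < d -> `|y| <= d ->
  cesaro_weight d y = 1 - d^-1 * `|y|.
Proof.
move=> d0 dy; rewrite /cesaro_weight; apply/max_idPl.
by rewrite subr_ge0 -ler_pdivlMl ?invr_gt0// invrK mulr1.
Qed.

Lemma cesaro_weight_le1 (d y : R) : 0 < d -> cesaro_weight d y <= 1.
Proof.
move=> d0; rewrite /cesaro_weight ge_max ler01 andbT gerBl.
by rewrite mulr_ge0// invr_ge0 ltW.
Qed.

(** The window [A] may exceed [h], so that weights of different widths can be summed over one common
    window. Its right end [x + A] is left out because the weight vanishes there. The index 0 is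
    harmless for the same reason, as [h <= x]. *)
Lemma cesaro_sumE g (h A x : nat) : (0 < h)%N -> (h <= A)%N -> (A <= x)%N ->
  cesaro_sum g h x =
  \sum_(i < A + A) cesaro_weight h%:R (i%:R - A%:R) * g (x - A + i)%N.
Proof.
move=> h0 hA Ax; have h0' : 0 < h%:R :> R by rewrite ltr0n.
pose F n := cesaro_weight h%:R (n%:R - x%:R) * g n.
have F0 n : (h <= n - x)%N || (h <= x - n)%N -> F n = 0.
  move=> hn; rewrite /F cesaro_weight_out ?mul0r//.
  case/orP: hn => hn.
    rewrite -natrB; last by lia.
    by rewrite normr_nat ler_nat.
  rewrite distrC -natrB; last by lia.
  by rewrite normr_nat ler_nat.
transitivity (\sum_(n < x - A + (A + A)) F n).
  rewrite fsbig_ord /cesaro_sum.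
  rewrite [LHS](@fsbig_widen _ _ _ _ _ setT)//; last first.
    by move=> n /= [_ /negP n0]; apply: F0; lia.
  rewrite [RHS](@fsbig_widen _ _ _ _ _ setT)//.
  by move=> n /= [_ /negP]; rewrite -leqNgt => hn; apply: F0; lia.
rewrite big_split_ord/= big1 ?add0r; last first.
  by move=> [i hi] _ /=; apply: F0; lia.
apply: eq_bigr => i _; rewrite /F; congr (cesaro_weight _ _ * _).
by rewrite natrD natrB//; lra.
Qed.

(** Pairs the rising half of the tent with the falling one: the weights at [x - h + t] and [x + t]
    add up to 1. The sum thus becomes [h] convex combinations, from which both the constant case and
    the bound by [h] times the maximum follow. *)
Lemma cesaro_sum_tent g (h x : nat) : (0 < h)%N -> (h <= x)%N ->
  cesaro_sum g h x =
  \sum_(t < h) (t%:R / h%:R * g (x - h + t)%N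
                + (1 - t%:R / h%:R) * g (x + t)%N).
Proof.
move=> h0 hx; have h0' : 0 < h%:R :> R by rewrite ltr0n.
rewrite (cesaro_sumE _ h0 (leqnn h) hx) big_split_ord big_split/=.
have th (t : 'I_h) : t%:R <= h%:R :> R by rewrite ler_nat ltnW.
congr (_ + _); apply: eq_bigr => t _; have := th t => {}th.
  rewrite cesaro_weight_in// ler0_norm ?subr_le0//.
    by congr (_ * _); field; rewrite gt_eqF.
  by have : 0 <= t%:R :> R by []; lra.
rewrite natrD addrAC subrr add0r cesaro_weight_in//; last by rewrite ger0_norm.
by rewrite ger0_norm// [_^-1 * _]mulrC; congr (_ * g _); lia.
Qed.

Lemma cesaro_sum_const (a : R) (h x : nat) : (0 < h)%N -> (h <= x)%N ->
  cesaro_sum (fun=> a) h x = h%:R * a.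
Proof.
move=> h0 hx; rewrite cesaro_sum_tent//.
under eq_bigr do rewrite -mulrDl addrC subrK mul1r.
by rewrite sumr_const card_ord mulr_natl.
Qed.

Lemma cesaro_sumB f g (h x : nat) : (0 < h)%N -> (h <= x)%N ->
  cesaro_sum (fun n => f n - g n) h x = cesaro_sum f h x - cesaro_sum g h x.
Proof.
move=> h0 hx; rewrite !cesaro_sum_tent// -sumrB.
by apply: eq_bigr => t _; ring.
Qed.

Lemma cesaro_sum_le g (G : R) (h x : nat) : (0 < h)%N -> (h <= x)%N ->
  (forall n, (x - h <= n <= x + h)%N -> `|g n| <= G) ->
  `|cesaro_sum g h x| <= h%:R * G.
Proof.
move=> h0 hx gG; have h0' : 0 < h%:R :> R by rewrite ltr0n.
rewrite cesaro_sum_tent//.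
apply: (@le_trans _ _ (\sum_(t < h) G)); last first.
  by rewrite sumr_const card_ord mulr_natl.
apply: (le_trans (ler_norm_sum _ _ _)); apply: ler_sum => -[t ht] _ /=.
have u0 : 0 <= t%:R / h%:R :> R by rewrite divr_ge0.
have u1 : t%:R / h%:R <= 1 :> R by rewrite ler_pdivrMr// mul1r ler_nat ltnW.
move: (t%:R / h%:R) u0 u1 => u u0 u1.
apply: (le_trans (ler_normD _ _)); rewrite !normrM (ger0_norm u0) (@ger0_norm _ (1 - _)) ?subr_ge0//.
have g1 : `|g (x - h + t)%N| <= G by apply: gG; lia.
have g2 : `|g (x + t)%N| <= G by apply: gG; lia.
have := ler_wpM2l u0 g1.
have : 0 <= 1 - u by rewrite subr_ge0.
by move/ler_wpM2l/(_ _ _ g2); lra.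
Qed.

(** * Piecewise linear interpolation of the weight *)

Lemma big_ord_mul (G : nat -> R) (m h : nat) :
  \sum_(i < m * h) G i = \sum_(k < m) \sum_(t < h) G (k * h + t)%N.
Proof.
elim: m => [|m IH]; first by rewrite !big_ord0.
by rewrite mulSn addnC big_split_ord/= IH [RHS]big_ord_recr.
Qed.

(* The interpolation is exact on the cells without [+-H] because [C_H] is affine
   off its endpoints [+-H] and its peak 0, which is a node. The left node of
   cell [k] is [(k - q.+1) * h]. *)
Lemma cesaro_weight_interp (h H k t : nat) (q := (H %/ h)%N)
    (v := fun k : nat => cesaro_weight H%:R ((k%:R - q.+1%:R) * h%:R) : R) :
  (0 < h)%N -> (h <= H)%N -> (k <= q.*2.+1)%N -> (t < h)%N ->
  `|cesaro_weight H%:R ((k * h + t)%:R - (q.+1 * h)%:R)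
     - (v k * (1 - t%:R / h%:R) + v k.+1 * (t%:R / h%:R))|
  <= if (k == 0)%N || (k == q.*2.+1)%N then h%:R / H%:R else 0.
Proof.
move=> h0 hH kq th.
have qh : (q * h <= H)%N by rewrite leq_trunc_div.
have qh1 : (H < q.+1 * h)%N by rewrite ltn_ceil.
have h0' : 0 < h%:R :> R by rewrite ltr0n.
have H0' : 0 < H%:R :> R by rewrite ltr0n; lia.
have {}qh : q%:R * h%:R <= H%:R :> R by rewrite -natrM ler_nat.
have {}qh1 : H%:R <= q.+1%:R * h%:R :> R by rewrite -natrM ler_nat ltnW.
pose u : R := t%:R / h%:R.
have u0 : 0 <= u by rewrite divr_ge0.
have u1 : u <= 1 by rewrite ler_pdivrMr// mul1r ler_nat ltnW.
rewrite -/u natrD !natrM.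
have -> : k%:R * h%:R + t%:R - q.+1%:R * h%:R = (k%:R - q.+1%:R + u) * h%:R.
  by rewrite /u; field; rewrite gt_eqF.
rewrite {}/v -[k.+1]addn1 natrD; rewrite -[q.+1]addn1 natrD in qh1 *.
have q0 : 0 <= q%:R :> R by [].
have hH' : h%:R <= H%:R :> R by rewrite ler_nat.
have Cl (y : R) : 0 <= y <= H%:R -> cesaro_weight H%:R y = 1 - y / H%:R.
  move=> /andP[y0 yH]; rewrite cesaro_weight_in// ger0_norm//.
  by rewrite mulrC.
have Cr (y : R) : - H%:R <= y <= 0 -> cesaro_weight H%:R y = 1 + y / H%:R.
  move=> /andP[y0 yH]; rewrite cesaro_weight_in// ler0_norm//; last by lra.
  by rewrite mulrC mulNr opprK.
(* The weight has slope [1 / d], so within [h] of its endpoints it is at most [h / d]. *)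
have Cs (d z : R) : 0 < d -> d - h%:R <= `|z| -> h%:R <= d ->
    cesaro_weight d z <= h%:R / d.
  move=> d0 dz hd; case: (leP d `|z|) => dz'.
    by rewrite cesaro_weight_out// divr_ge0// ltW.
  rewrite (cesaro_weight_in d0 (ltW dz')) [d^-1 * _]mulrC ler_pdivlMr// mulrBl mul1r.
  by rewrite divfK ?gt_eqF//; lra.
(* On an outer cell the weight and the convex combination of its nodal values both lie in the
   interval from 0 to [h / H], hence so does the size of their difference. *)
have bnd (a b c d : R) : 0 <= a -> 0 <= b -> 0 <= c -> a <= d -> b <= d ->
   c <= d -> `|a - (b * (1 - u) + c * u)| <= d.
  by move=> *; rewrite ler_norml; nra.
have outer (a b c : R) : H%:R - h%:R <= `|a| -> H%:R - h%:R <= `|b| ->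
    H%:R - h%:R <= `|c| -> `|cesaro_weight H%:R a - (cesaro_weight H%:R b *
      (1 - u) + cesaro_weight H%:R c * u)| <= h%:R / H%:R.
  by move=> *; apply: bnd; rewrite ?cesaro_weight_ge0 ?Cs.
case: eqP => [->|/eqP k0] /=.
  by apply: outer; rewrite ler0_norm; nra.
case: eqP => [kE|/eqP k1] /=.
  have {}kE : k%:R = q%:R * 2 + 1 :> R by rewrite kE -muln2 -addn1 natrD natrM.
  by rewrite kE; apply: outer; rewrite ger0_norm; nra.
rewrite normr_le0 subr_eq0; apply/eqP.
(* The peak is node [q.+1]: cells with [k <= q] lie left of it, where the weight is [1 + y / H], and
   the later ones right of it, where it is [1 - y / H]. *)
case: (leqP k q) => kq'.
  have k2 : 1 <= k%:R :> R by rewrite ler1n lt0n.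
  have k3 : k%:R <= q%:R :> R by rewrite ler_nat.
  rewrite !Cr; first by field; rewrite gt_eqF.
  - by apply/andP; split; nra.
  - by apply/andP; split; nra.
  - by apply/andP; split; nra.
have k2 : q%:R + 1 <= k%:R :> R by rewrite natr1 ler_nat.
have k3 : k%:R <= 2 * q%:R :> R by rewrite -natrM ler_nat; lia.
rewrite !Cl; first by field; rewrite gt_eqF.
- by apply/andP; split; nra.
- by apply/andP; split; nra.
- by apply/andP; split; nra.
Qed.

(** Sums the pointwise interpolation error: two outer cells, [h] points in each, an error of [h / H]
    in the weight and [G] for the values of [g]. *)
Lemma cesaro_sum_interp g (G : R) (h H x : nat) (q := (H %/ h)%N)
    (v := fun k : nat => cesaro_weight H%:R ((k%:R - q.+1%:R) * h%:R) : R) :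
  (0 < h)%N -> (h <= H)%N -> (q.+1 * h <= x)%N ->
  (forall n, (x - q.+1 * h <= n <= x + q.+1 * h)%N -> `|g n| <= G) ->
  `|cesaro_sum g H x
    - \sum_(j < q.*2.+1) v j.+1 * cesaro_sum g h (x - q * h + j * h)|
  <= 2 * (h%:R * (h%:R / H%:R) * G).
Proof.
move=> h0 hH qx gG.
have H0 : (0 < H)%N by lia.
have H0' : 0 < H%:R :> R by rewrite ltr0n.
have qh1 : (H < q.+1 * h)%N by rewrite ltn_ceil.
pose a := (x - q.+1 * h)%N.
(* The extreme nodes lie at distance [q.+1 * h >= H] from the centre, so their tents, which would
   stick out of the window, carry weight 0. *)
have v0 : v 0%N = 0.
  rewrite /v cesaro_weight_out// sub0r mulNr normrN -natrM normr_nat ler_nat.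
  exact: ltnW.
have v1 : v q.*2.+2 = 0.
  rewrite /v cesaro_weight_out// -natrB; last by lia.
  by rewrite -natrM normr_nat ler_nat; lia.
(* Regroups tents into cells: the tent at node [j.+1] rises over cell [j] and falls over cell
   [j.+1]. *)
have -> : \sum_(j < q.*2.+1) v j.+1 * cesaro_sum g h (x - q * h + j * h) =
    \sum_(k < q.*2.+2) \sum_(t < h)
      (v k * (1 - t%:R / h%:R) + v k.+1 * (t%:R / h%:R)) * g (a + (k * h + t))%N.
  under [RHS]eq_bigr do under eq_bigr do rewrite mulrDl.
  under [RHS]eq_bigr do rewrite big_split/=.
  rewrite big_split/= [X in X + _]big_ord_recl [X in _ + X]big_ord_recr/= v0 v1.
  rewrite [X in X + _ + _]big1; last by move=> *; rewrite !mul0r.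
  rewrite [X in _ + (_ + X)]big1; last by move=> *; rewrite !mul0r.
  rewrite add0r addr0 -big_split/=; apply: eq_bigr => j _.
  rewrite cesaro_sum_tent//; last by lia.
  rewrite mulr_sumr -big_split/=; apply: eq_bigr => t _.
  rewrite mulrDr addrC !mulrA; congr (_ * g _ + _ * g _); rewrite /a /bump/=; lia.
(* Widening the window from [H] to [q.+1 * h] makes it a whole number of cells of length [h]. *)
rewrite (@cesaro_sumE g H (q.+1 * h))//; last exact: ltnW.
have -> : (q.+1 * h + q.+1 * h = q.*2.+2 * h)%N by lia.
rewrite (big_ord_mul (fun i => cesaro_weight H%:R (i%:R - (q.+1 * h)%:R)
   * g (x - q.+1 * h + i)%N)).
rewrite -sumrB.
under eq_bigr do rewrite -sumrB.
under eq_bigr do under eq_bigr do rewrite -mulrBl.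
pose e k : R := if (k == 0)%N || (k == q.*2.+1)%N then h%:R / H%:R else 0.
apply: (@le_trans _ _ (\sum_(k < q.*2.+2) \sum_(t < h) e k * G)).
  apply: (le_trans (ler_norm_sum _ _ _)); apply: ler_sum => -[k kq] _ /=.
  apply: (le_trans (ler_norm_sum _ _ _)); apply: ler_sum => -[t th] _ /=.
  rewrite normrM ler_pM//.
    by have := @cesaro_weight_interp h H k t h0 hH kq th.
  apply: gG; rewrite leq_addr/=.
  by have := leq_mul kq (leqnn h); rewrite mulSn; lia.
under eq_bigr do rewrite sumr_const card_ord -mulr_natl mulrA.
rewrite big_ord_recl big_ord_recr/= big1; last first.
  move=> [i hi] _; rewrite /e /bump/= add1n eqSS; case: eqP; first lia.
  by rewrite mulr0 mul0r.
by rewrite /e /bump/= add1n eqxx add0r mulr2n mulrDl mul1r.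
Qed.

(** * Growth and variation of the logarithmic polynomial *)

Lemma ler_norm_exprB (u v M : R) (i : nat) :
  0 <= u <= M -> 0 <= v <= M -> 1 <= M ->
  `|u ^+ i - v ^+ i| <= i%:R * M ^+ i * `|u - v|.
Proof.
move=> /andP[u0 uM] /andP[v0 vM] M1.
elim: i => [|i IH]; first by rewrite !expr0 subrr normr0 !mul0r.
have -> : u ^+ i.+1 - v ^+ i.+1 = u * (u ^+ i - v ^+ i) + (u - v) * v ^+ i.
  by rewrite !exprS; ring.
apply: (le_trans (ler_normD _ _)); rewrite !normrM (ger0_norm u0).
have vi : `|v ^+ i| <= M ^+ i by rewrite normrX ger0_norm// lerXn2r// nnegrE; lra.
have M0 : 0 <= M ^+ i by rewrite exprn_ge0//; lra.
apply: (@le_trans _ _ (M * (i%:R * M ^+ i * `|u - v|) + M * M ^+ i * `|u - v|)).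
  apply: lerD; first by rewrite ler_pM.
  by rewrite mulrC ler_wpM2r// (le_trans vi)// ler_peMl.
by rewrite -natr1 exprS; lra.
Qed.

(** One constant serves both bounds: in [i.+1], the term [i] comes from the difference of [i]-th
    powers and the 1 covers the value itself. As [1 <= M], every power is dominated by the top
    one. *)
Lemma horner_growth p : exists2 A : R, 0 <= A & forall M u v : R,
  1 <= M -> 0 <= u <= M -> 0 <= v <= M ->
  `|p.[u]| <= A * M ^+ (size p).-1 /\
  `|p.[u] - p.[v]| <= A * M ^+ (size p).-1 * `|u - v|.
Proof.
exists (\sum_(i < size p) `|p`_i| * i.+1%:R).
  by apply: sumr_ge0 => i _; rewrite mulr_ge0.
move=> M u v M1 uM vM.
have MX (i : 'I_(size p)) : 0 <= M ^+ i <= M ^+ (size p).-1.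
  rewrite exprn_ge0 ?(le_trans ler01)//= ler_weXn2l//.
  by rewrite -ltnS prednK// (leq_ltn_trans _ (ltn_ord i)).
rewrite !horner_coef; split.
  apply: (le_trans (ler_norm_sum _ _ _)); rewrite mulr_suml.
  apply: ler_sum => i _; rewrite normrM -mulrA ler_wpM2l//.
  have /andP[MX0 MX1] := MX i.
  case/andP: uM => u0 uM.
  rewrite normrX ger0_norm// (@le_trans _ _ (M ^+ i))//.
    by rewrite lerXn2r// nnegrE; lra.
  by apply: (le_trans MX1); rewrite ler_peMl ?ler1n// (le_trans MX0).
rewrite -sumrB; apply: (le_trans (ler_norm_sum _ _ _)); rewrite !mulr_suml.
apply: ler_sum => i _; rewrite -mulrBr normrM -!mulrA ler_wpM2l//.
have /andP[MX0 MX1] := MX i.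
apply: (le_trans (ler_norm_exprB i uM vM M1)).
rewrite -mulrA ler_pM ?ler_nat// ?mulr_ge0// ler_wpM2r//.
Qed.

(** For [y <= x] this is [ln (1 + t) <= t] at [t = (x - y) / y], followed by [N <= y]. *)
Lemma ler_dist_ln (N x y : R) : 0 < N -> N <= x -> N <= y ->
  `|ln x - ln y| <= `|x - y| / N.
Proof.
move=> N0; wlog yx : x y / y <= x => [H Nx Ny|Nx Ny].
  case: (leP y x) => [yx|/ltW xy]; first exact: H.
  by rewrite distrC [in leRHS]distrC H.
have y0 : 0 < y by lra.
have x0 : 0 < x by lra.
rewrite !ger0_norm ?subr_ge0 ?ler_ln//.
rewrite -ln_div// -[x / y](subrK 1) [X in ln X]addrC.
apply: (@le_trans _ _ (x / y - 1)).
  by apply: le_ln1Dx; rewrite ltrBrDl subrr divr_gt0.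
have -> : x / y - 1 = (x - y) / y by field; rewrite gt_eqF.
by rewrite ler_wpM2l ?subr_ge0// lef_pV2.
Qed.

Lemma horner_ln_growth p : exists2 A : R, 0 <= A & forall N x y : nat,
  1 <= ln N%:R :> R -> (N < x <= 2 * N)%N -> (N < y <= 2 * N)%N ->
  `|p.[ln x%:R]| <= A * ln N%:R ^+ (size p).-1 /\
  `|p.[ln x%:R] - p.[ln y%:R]|
    <= A * ln N%:R ^+ (size p).-1 * (`|x%:R - y%:R| / N%:R).
Proof.
have [A A0 pA] := horner_growth p.
exists (A * 2 ^+ (size p).-1); first by rewrite mulr_ge0// exprn_ge0.
move=> N x y lnN hx hy.
have N1 : N != 1%N by apply: contraTneq lnN => ->; rewrite ln1 ler10.
have N0' : 0 < N%:R :> R by rewrite ltr0n; lia.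
(* For [N >= 2] one has [z <= 2 * N <= N * N], so [M = 2 * ln N] is admissible; the power of 2 goes
   into the constant. *)
have lnNM z : (N < z <= 2 * N)%N -> 0 <= ln (z%:R : R) <= 2 * ln (N%:R : R).
  move=> /andP[Nz zN]; have z0 : (0 < z)%N by lia.
  rewrite ln_ge0 ?ler1n//= mulrDl mul1r -lnM ?posrE//.
  rewrite ler_ln ?posrE ?ltr0n//; last by rewrite mulr_gt0.
  by rewrite -natrM ler_nat; nia.
have M1 : 1 <= 2 * ln N%:R :> R by lra.
have [p1 p2] := pA _ _ _ M1 (lnNM _ hx) (lnNM _ hy).
rewrite exprMn mulrA in p1 p2; split => //.
apply: (le_trans p2); rewrite ler_wpM2l//.
  by rewrite !mulr_ge0// exprn_ge0//; lra.
by apply: ler_dist_ln => //; rewrite ler_nat; lia.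
Qed.

(** * Cauchy-Schwarz and the defects at a single point *)

Lemma sqr_sum_le (m : nat) (a : 'I_m -> R) :
  (\sum_i a i) ^+ 2 <= m%:R * \sum_i a i ^+ 2.
Proof.
rewrite expr2 mulr_suml.
apply: (@le_trans _ _ (\sum_i \sum_j (a i ^+ 2 + a j ^+ 2) / 2)).
  apply: ler_sum => i _; rewrite mulr_sumr; apply: ler_sum => j _.
  by have := sqr_ge0 (a i - a j); rewrite sqrrB; lra.
under eq_bigr do rewrite -mulr_suml big_split/= sumr_const card_ord.
rewrite -mulr_suml big_split/= sumr_const card_ord sumrMnl -[_ *+ m]mulr_natl.
by lra.
Qed.

Definition selberg_defect f p (h x : nat) : R :=
  cesaro_sum f h x - main_term p x h.

Lemma selberg_tildeE f p (N h : nat) :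
  selberg_tilde f p N h = \sum_(i < N) selberg_defect f p h (N.+1 + i) ^+ 2.
Proof.
rewrite /selberg_tilde -{1}[N.+1]add0n big_addn.
have -> : ((2 * N).+1 - N.+1 = N)%N by lia.
rewrite big_mkord; apply: eq_bigr => i _; rewrite real_normK ?num_real//.
by rewrite addnC.
Qed.

Lemma supnorm_ge f (N H n : nat) : (N - H <= n <= 2 * N + H)%N ->
  `|f n| <= supnorm f N H.
Proof.
move=> hn; rewrite /supnorm; apply: (le_bigmax_seq 0 n xpredT) => //.
by rewrite mem_index_iota; lia.
Qed.

(** The trivial estimate, meant for the [x] within [H] of either end of the range, where the points
    [x + j h] may leave it. *)
Lemma selberg_defect_le f p (A L : R) (N H x : nat) :
  (0 < H)%N -> (H <= N)%N -> (N < x <= 2 * N)%N ->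
  `|p.[ln x%:R]| <= A * L ->
  `|selberg_defect f p H x| <= H%:R * (supnorm f N H + A * L).
Proof.
move=> H0 HN xN px; rewrite mulrDr (le_trans (ler_normB _ _))// lerD//.
  apply: cesaro_sum_le => //; first by lia.
  by move=> n hn; apply: supnorm_ge; lia.
by rewrite normrM normr_nat ler_wpM2l.
Qed.

(* Interpolating the weight against [f n - p(ln x)] rather than [f n] makes the
   interpolation error cost [h^2/H * |p(ln x)|], and
   [h * |p(ln x)| <= |D_h(x)| + h * ||f||], so that no power of the logarithm
   enters the error term [N h^4 / H^2]. *)
Lemma selberg_defect_interp f p (A L : R) (N h H x : nat) (q := (H %/ h)%N) :
  (0 < h)%N -> (h <= H)%N -> (4 * H <= N)%N -> (N + H < x <= 2 * N - H)%N ->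
  0 <= A * L ->
  (forall y, (N < y <= 2 * N)%N ->
     `|p.[ln y%:R] - p.[ln x%:R]| <= A * L * (`|y%:R - x%:R| / N%:R)) ->
  `|selberg_defect f p H x| <=
    \sum_(j < q.*2.+1) `|selberg_defect f p h (x - q * h + j * h)|
    + 3 * (A * L) * (H%:R ^+ 2 / N%:R)
    + 4 * (h%:R ^+ 2 / H%:R) * supnorm f N H
    + 2 * (h%:R / H%:R) * `|selberg_defect f p h x|.
Proof.
move=> h0 hH HN xN AL pL.
have H0 : (0 < H)%N by lia.
have h0' : 0 < h%:R :> R by rewrite ltr0n.
have H0' : 0 < H%:R :> R by rewrite ltr0n.
have N0' : 0 < N%:R :> R by rewrite ltr0n; lia.
have qh : (q * h <= H)%N by rewrite leq_trunc_div.
have qh1 : (H < q.+1 * h)%N by rewrite ltn_ceil.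
set P := p.[ln x%:R]; set S := supnorm f N H.
(* Since [q.+1 * h <= 2 * H], keeping [x] at distance [H] from the ends of the range keeps [n]
   inside the range of [supnorm]. *)
have gS n : (x - q.+1 * h <= n <= x + q.+1 * h)%N -> `|f n - P| <= S + `|P|.
  move=> hn; rewrite (le_trans (ler_normB _ _))// lerD2r.
  by apply: supnorm_ge; lia.
have := cesaro_sum_interp h0 hH _ gS.
(* Subtracting the constant [P] costs the variation of the polynomial between [x] and [z], which
   vanishes at [z = x]. *)
have csE k z : (0 < k)%N -> (k <= z)%N -> cesaro_sum (fun n => f n - P) k z =
    selberg_defect f p k z + k%:R * (p.[ln z%:R] - P).
  move=> k0 kz; rewrite (cesaro_sumB _ (fun=> P))// cesaro_sum_const//.
  by rewrite /selberg_defect /main_term; ring.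
rewrite csE//; last by lia.
rewrite subrr mulr0 addr0 -/q => /(_ ltac:(lia)).
set T := \sum_(j < _) _ => DT.
have jq (j : 'I_q.*2.+1) : (j * h <= 2 * (q * h))%N.
  by rewrite mulnA leq_mul2r; have := ltn_ord j; lia.
have TE : `|T| <= \sum_(j < q.*2.+1)
   (`|selberg_defect f p h (x - q * h + j * h)| + h%:R * (A * L * (H%:R / N%:R))).
  apply: (le_trans (ler_norm_sum _ _ _)); apply: ler_sum => j _.
  have hj := jq j.
  rewrite csE//; last by lia.
  rewrite normrM ger0_norm ?cesaro_weight_ge0//.
  apply: (@le_trans _ _ (1 * `|selberg_defect f p h (x - q * h + j * h) +
    h%:R * (p.[ln (x - q * h + j * h)%:R] - P)|)).
    by rewrite ler_wpM2r// cesaro_weight_le1.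
  rewrite mul1r (le_trans (ler_normD _ _))// lerD2l normrM normr_nat ler_wpM2l//.
  rewrite (le_trans (pL _ _))//; first by lia.
  rewrite ler_wpM2l// ler_wpM2r ?invr_ge0// ler_norml lerBrDl lerBlDl.
  by rewrite lerBlDr -!natrD !ler_nat; lia.
rewrite big_split/= sumr_const card_ord -mulr_natl in TE.
have hP : h%:R * `|P| <= `|selberg_defect f p h x| + h%:R * S.
  have -> : h%:R * `|P| = `|cesaro_sum f h x - selberg_defect f p h x|.
    by rewrite /selberg_defect opprB addrC subrK normrM normr_nat.
  rewrite (le_trans (ler_normB _ _))// addrC lerD2l.
  apply: cesaro_sum_le => //; first by lia.
  by move=> n hn; apply: supnorm_ge; lia.
(* The number of nodes is at most [3 * H / h], because [q * h] and [h] are both at most [H]. *)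
have q3 : q.*2.+1%:R * h%:R <= 3 * H%:R :> R.
  by rewrite -!natrM ler_nat; lia.
have E1 : q.*2.+1%:R * (h%:R * (A * L * (H%:R / N%:R))) <=
    3 * (A * L) * (H%:R ^+ 2 / N%:R).
  have -> : 3 * (A * L) * (H%:R ^+ 2 / N%:R) = 3 * H%:R * (A * L * (H%:R / N%:R)).
    by field; rewrite gt_eqF.
  by rewrite mulrA ler_wpM2r// mulr_ge0// divr_ge0// ltW.
have E2 : 2 * (h%:R * (h%:R / H%:R) * (S + `|P|)) <=
   4 * (h%:R ^+ 2 / H%:R) * S + 2 * (h%:R / H%:R) * `|selberg_defect f p h x|.
  have -> : 2 * (h%:R * (h%:R / H%:R) * (S + `|P|)) =
    2 * (h%:R / H%:R) * (h%:R * S + h%:R * `|P|) by ring.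
  have -> : 4 * (h%:R ^+ 2 / H%:R) * S + 2 * (h%:R / H%:R) * `|selberg_defect f p h x|
   = 2 * (h%:R / H%:R) * (h%:R * S + (`|selberg_defect f p h x| + h%:R * S)).
    by ring.
  by rewrite ler_wpM2l ?mulr_ge0 ?divr_ge0// lerD2l.
have := ler_normD T (selberg_defect f p H x - T); rewrite addrC subrK.
by lra.
Qed.

(** * Summation over the range of x *)

Lemma ler_sum_block (F : nat -> R) (s m N : nat) : (forall i, 0 <= F i) ->
  (s + m <= N)%N -> \sum_(i < m) F (s + i)%N <= \sum_(i < N) F i.
Proof.
move=> F0 sN; have -> : \sum_(i < N) F i = \sum_(i < s + (m + (N - s - m))) F i.
  by have <- : N = (s + (m + (N - s - m)))%N by lia.
rewrite !big_split_ord/= addrCA lerDl addr_ge0//; exact: sumr_ge0.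
Qed.

(** The middle range contributes 52, 64 and [36 * A ^+ 2]; the two edges of [H] points together add
    4 and [4 * A ^+ 2]. The constant dominates all of these. *)
Lemma selberg_tilde_bound f p (A L : R) (N h H : nat) :
  (0 < h)%N -> (h <= H)%N -> (4 * H <= N)%N -> 0 <= A * L ->
  (forall x y, (N < x <= 2 * N)%N -> (N < y <= 2 * N)%N ->
     `|p.[ln x%:R]| <= A * L /\
     `|p.[ln x%:R] - p.[ln y%:R]| <= A * L * (`|x%:R - y%:R| / N%:R)) ->
  selberg_tilde f p N H <=
    (68 + 40 * A ^+ 2) *
    (H%:R ^+ 2 / h%:R ^+ 2 * selberg_tilde f p N h
     + (N%:R * h%:R ^+ 4 / H%:R ^+ 2 + H%:R ^+ 3) * supnorm f N H ^+ 2
     + H%:R ^+ 3 * L ^+ 2).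
Proof.
move=> h0 hH HN AL pL.
have H0 : (0 < H)%N by lia.
have HN' : (H <= N)%N by lia.
have h0' : 0 < h%:R :> R by rewrite ltr0n.
have H0' : 0 < H%:R :> R by rewrite ltr0n.
have N0' : 0 < N%:R :> R by rewrite ltr0n; lia.
pose q := (H %/ h)%N.
have qh : (q * h <= H)%N by rewrite leq_trunc_div.
set S := supnorm f N H.
set J := selberg_tilde f p N h.
have JE : J = \sum_(i < N) selberg_defect f p h (N.+1 + i) ^+ 2.
  exact: selberg_tildeE.
(* The middle range has [N - 2 * H] points, so its translates by the shifts [H - q * h + j * h],
   which are at most [2 * H], run inside the full range, and each sum is at most [J]. *)
have shift_le s : (s <= 2 * H)%N ->
    \sum_(m < N - 2 * H) selberg_defect f p h (N.+1 + (s + m)) ^+ 2 <= J.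
  move=> sH; rewrite JE.
  apply: (@ler_sum_block (fun i => selberg_defect f p h (N.+1 + i) ^+ 2)).
    by move=> i; exact: sqr_ge0.
  by lia.
have J0 : 0 <= J by rewrite JE; apply: sumr_ge0 => i _; exact: sqr_ge0.
pose G i := selberg_defect f p H (N.+1 + i) ^+ 2.
have edge i : (i < N)%N -> G i <= H%:R ^+ 2 * (2 * S ^+ 2 + 2 * (A * L) ^+ 2).
  move=> iN; have xN : (N < N.+1 + i <= 2 * N)%N by lia.
  have [pA _] := pL _ _ xN xN.
  have := selberg_defect_le f H0 HN' xN pA.
  rewrite -/S /G -real_normK ?num_real// => dS.
  apply: (@le_trans _ _ ((H%:R * (S + A * L)) ^+ 2)).
    by rewrite lerXn2r// nnegrE ?(le_trans (normr_ge0 _) dS).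
  rewrite exprMn ler_wpM2l ?exprn_ge0//.
  by have := sqr_ge0 (S - A * L); rewrite sqrrB sqrrD; lra.
(* Squaring four terms costs a factor 4, so 52 = 4 (9 + 4), 36 = 4 * 9 and 64 = 4 * 16. The first 9
   is from [Q ^+ 2 <= 9 * H^2 / h^2], the added 4 from the defect of [h] at [x] itself with
   [r <= 1 <= H / h]; the other 9 and 16 are the squared constants of [E1] and [E2]. *)
have mid : \sum_(m < N - 2 * H) G (H + m)%N <=
    52 * (H%:R ^+ 2 / h%:R ^+ 2) * J + 36 * (A * L) ^+ 2 * H%:R ^+ 3
    + 64 * (N%:R * h%:R ^+ 4 / H%:R ^+ 2) * S ^+ 2.
  pose x m := (N.+1 + (H + m))%N.
  pose a m (j : 'I_q.*2.+1) := selberg_defect f p h (x m - q * h + j * h).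
  pose E1 : R := 3 * (A * L) * (H%:R ^+ 2 / N%:R).
  pose E2 : R := 4 * (h%:R ^+ 2 / H%:R) * S.
  pose r : R := h%:R / H%:R.
  pose Q : R := q.*2.+1%:R.
  have pt m : (m < N - 2 * H)%N -> G (H + m)%N <=
      4 * (Q * (\sum_j a m j ^+ 2) + (E1 ^+ 2 + E2 ^+ 2)
           + 4 * r ^+ 2 * selberg_defect f p h (x m) ^+ 2).
    move=> hm; have hx : (N + H < x m <= 2 * N - H)%N by rewrite /x; lia.
    have hx' : (N < x m <= 2 * N)%N by lia.
    have := @selberg_defect_interp f p A L N h H (x m) h0 hH HN hx AL
      (fun y hy => (pL _ _ hy hx').2).
    rewrite -/q -/S -/E1 -/E2 -/r => dx.
    have := sqr_sum_le (fun j => `|a m j|).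
    under [X in _ <= _ * X]eq_bigr do rewrite real_normK ?num_real//.
    move: dx; rewrite -/Q -/(a m _).
    set T := \sum_(j < _) _ => dx T2.
    rewrite /G -[leLHS]real_normK ?num_real// -/(x m).
    rewrite -[X in _ * r ^+ 2 * X]real_normK ?num_real//.
    set y := `|selberg_defect f p h (x m)| in dx *.
    apply: (@le_trans _ _ ((T + E1 + E2 + 2 * r * y) ^+ 2)).
      by rewrite lerXn2r// nnegrE ?(le_trans (normr_ge0 _) dx).
    have -> : 4 * r ^+ 2 * y ^+ 2 = (2 * r * y) ^+ 2 by ring.
    move: (2 * r * y) => E3.
    have := sqr_ge0 (T - E1); have := sqr_ge0 (T - E2).
    have := sqr_ge0 (T - E3); have := sqr_ge0 (E1 - E2).
    by have := sqr_ge0 (E1 - E3); have := sqr_ge0 (E2 - E3); nra.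
  have q3 : Q <= 3 * (H%:R / h%:R).
    rewrite mulrA ler_pdivlMr// -!natrM ler_nat; lia.
  have sumJ : \sum_(m < N - 2 * H) \sum_j a m j ^+ 2 <= Q * J.
    rewrite exchange_big/=.
    apply: (@le_trans _ _ (\sum_(j < q.*2.+1) J)); last first.
      by rewrite sumr_const card_ord mulr_natl.
    apply: ler_sum => j _.
    have jq : (j * h <= 2 * (q * h))%N.
      by rewrite mulnA leq_mul2r; have := ltn_ord j; lia.
    have := shift_le (H - q * h + j * h)%N ltac:(lia).
    apply: le_trans; rewrite le_eqVlt; apply/orP; left; apply/eqP.
    by apply: eq_bigr => m _; rewrite /a /x; congr (selberg_defect _ _ _ _ ^+ 2); lia.
  apply: (@le_trans _ _ (\sum_(m < N - 2 * H)
      4 * (Q * (\sum_j a m j ^+ 2) + (E1 ^+ 2 + E2 ^+ 2)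
           + 4 * r ^+ 2 * selberg_defect f p h (x m) ^+ 2))).
    by apply: ler_sum => m _; exact: pt.
  rewrite -mulr_sumr !big_split/= !sumr_const card_ord -!mulr_sumr.
  have sumD : \sum_(m < N - 2 * H) selberg_defect f p h (x m) ^+ 2 <= J.
    by apply: shift_le; lia.
  have Q0 : 0 <= Q by [].
  have t1 : Q * (\sum_(m < N - 2 * H) \sum_j a m j ^+ 2) <=
      9 * (H%:R ^+ 2 / h%:R ^+ 2) * J.
    rewrite (le_trans (ler_wpM2l Q0 sumJ))// [Q * (Q * J)]mulrA ler_wpM2r//.
    have -> : 9 * (H%:R ^+ 2 / h%:R ^+ 2) =
        (3 * (H%:R / h%:R)) * (3 * (H%:R / h%:R)) :> R.
      by field; rewrite gt_eqF.
    by rewrite ler_pM.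
  have r1 : r <= 1 by rewrite ler_pdivrMr// mul1r ler_nat.
  have r0 : 0 <= r by rewrite divr_ge0.
  have R1 : 1 <= H%:R ^+ 2 / h%:R ^+ 2 :> R.
    by rewrite ler_pdivlMr ?exprn_gt0// mul1r lerXn2r ?nnegrE// ler_nat.
  have t2 : 4 * r ^+ 2 * (\sum_(m < N - 2 * H) selberg_defect f p h (x m) ^+ 2)
      <= 4 * (H%:R ^+ 2 / h%:R ^+ 2) * J.
    rewrite ler_pM ?mulr_ge0 ?sqr_ge0//.
      by apply: sumr_ge0 => *; exact: sqr_ge0.
    by rewrite ler_wpM2l// (le_trans _ R1)// expr_le1.
  have NX (X : R) : 0 <= X -> X *+ (N - 2 * H) <= N%:R * X.
    by move=> X0; rewrite mulr_natl ler_wpMn2l// leq_subr.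
  (* Summing [E1 ^+ 2] yields an extra factor [H / N], which is bounded by 1. *)
  have t3 : E1 ^+ 2 *+ (N - 2 * H) <= 9 * (A * L) ^+ 2 * H%:R ^+ 3.
    rewrite (le_trans (NX _ (sqr_ge0 _)))//.
    have -> : N%:R * E1 ^+ 2 = 9 * (A * L) ^+ 2 * H%:R ^+ 3 * (H%:R / N%:R).
      by rewrite /E1; field; rewrite gt_eqF.
    rewrite ler_piMr//.
      by rewrite (mulr_ge0 (mulr_ge0 _ (sqr_ge0 _)) (exprn_ge0 _ _)).
    by rewrite ler_pdivrMr// mul1r ler_nat.
  have t4 : E2 ^+ 2 *+ (N - 2 * H) <= 16 * (N%:R * h%:R ^+ 4 / H%:R ^+ 2) * S ^+ 2.
    rewrite (le_trans (NX _ (sqr_ge0 _)))// le_eqVlt; apply/orP; left; apply/eqP.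
    by rewrite /E2; field; rewrite gt_eqF.
  by lra.
rewrite selberg_tildeE -/(G _).
have -> : \sum_(i < N) selberg_defect f p H (N.+1 + i) ^+ 2 =
    \sum_(i < H + (N - 2 * H + H)) G i.
  by have <- : N = (H + (N - 2 * H + H))%N by lia.
rewrite big_split_ord big_split_ord/=.
set E := H%:R ^+ 2 * (2 * S ^+ 2 + 2 * (A * L) ^+ 2) in edge.
have e1 : \sum_(i < H) G i <= H%:R * E.
  apply: (@le_trans _ _ (\sum_(i < H) E)).
    by apply: ler_sum => -[i iH] _; apply: edge => /=; lia.
  by rewrite sumr_const card_ord mulr_natl.
have e2 : \sum_(i < H) G (H + (N - 2 * H + i))%N <= H%:R * E.
  apply: (@le_trans _ _ (\sum_(i < H) E)).
    by apply: ler_sum => -[i iH] _; apply: edge => /=; lia.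
  by rewrite sumr_const card_ord mulr_natl.
apply: (le_trans (lerD e1 (lerD mid e2))).
rewrite /E.
set u := H%:R ^+ 2 / h%:R ^+ 2 in mid *.
set v := N%:R * h%:R ^+ 4 / H%:R ^+ 2 in mid *.
set w := H%:R ^+ 3.
have u0 : 0 <= u * J by rewrite mulr_ge0// divr_ge0// exprn_ge0.
have v0 : 0 <= v * S ^+ 2.
  by rewrite mulr_ge0 ?sqr_ge0// divr_ge0 ?mulr_ge0 ?exprn_ge0.
have w0 : 0 <= w * S ^+ 2 by rewrite mulr_ge0 ?sqr_ge0// exprn_ge0.
have z0 : 0 <= w * L ^+ 2 by rewrite mulr_ge0 ?sqr_ge0// exprn_ge0.
have -> : H%:R * (H%:R ^+ 2 * (2 * S ^+ 2 + 2 * (A * L) ^+ 2)) =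
  w * (2 * S ^+ 2 + 2 * (A * L) ^+ 2) by rewrite /w; ring.
have A0 : 0 <= A ^+ 2 by exact: sqr_ge0.
have := mulr_ge0 A0 u0; have := mulr_ge0 A0 v0; have := mulr_ge0 A0 w0.
by lra.
Qed.
End WeightInterpolation.

(** * Passage to large N *)

Theorem theorem2 (R : realType) (f : nat -> R) (F : R[i]^o -> R[i]^o)
    (p : {poly R}) (c : nat)
    (hF : meromorphic_dirichlet_series f F)
    (hp : is_logarithmic_polynomial F p)
    (hc : c = (size p).-1) :
  exists2 K : R, 0 < K &
    forall h H : nat -> nat,
      (\forall N \near \oo, (h N <= H N)%N) ->
      h @ \oo --> \oo ->
      (H N)%:R / N%:R @[N --> \oo] --> (0 : R) ->
      \forall N \near \oo,
        selberg_tilde f p N (H N) <=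
        K * ((H N)%:R ^+ 2 / (h N)%:R ^+ 2 * selberg_tilde f p N (h N)
             + (N%:R * (h N)%:R ^+ 4 / (H N)%:R ^+ 2 + (H N)%:R ^+ 3)
               * supnorm f N (H N) ^+ 2
             + (H N)%:R ^+ 3 * ln N%:R ^+ (2 * c)).
Proof.
(* [A] depends on [p] alone, so the constant is uniform in the functions [h] and [H]. *)
have [A A0 pA] := horner_ln_growth p.
exists (68 + 40 * A ^+ 2); first by have := sqr_ge0 A; lra.
move=> h H hH hoo Ho.
have h0 : \forall N \near \oo, (0 < h N)%N.
  exact: (hoo [set n | (0 < n)%N] (nbhs_infty_gt 0)).
have H4 : \forall N \near \oo, (4 * H N <= N)%N.
  have /cvgr0_norm_lt/(_ (1 / 4) ltac:(lra)) := Ho.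
  apply: filterS2 (nbhs_infty_gt 0) => N N0.
  have N0' : 0 < N%:R :> R by rewrite ltr0n.
  rewrite ger0_norm ?divr_ge0// ltr_pdivrMr// => HN.
  by rewrite -(ler_nat R) natrM; lra.
have lnN : \forall N \near \oo, 1 <= ln (N%:R : R).
  near=> N; have N1 : expR 1 <= N%:R :> R by near: N; exact: nbhs_infty_ger.
  by rewrite -[leLHS]expRK ler_ln ?posrE ?expR_gt0// (lt_le_trans _ N1)// expR_gt0.
(* Writes the power of the logarithm as [L ^+ 2] with [L = ln N ^+ c]. *)
near=> N; rewrite hc mulnC exprM.
have lnN1 : 1 <= ln (N%:R : R) by near: N.
apply: (@selberg_tilde_bound _ _ _ A); [by near: N..| |].
  by rewrite mulr_ge0// exprn_ge0// (le_trans ler01).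
by move=> x y; exact: pA.
Unshelve. all: by end_near. Qed.
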